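(* Let $X'\subset X$ and $g\in\mathcal{G}$. Assume that $\{(\partial^\circ g)^{-1}(y)\}_{y\in\mathrm{ldom}(B^\circ g)}$ is a covering of $X'\cap\mathrm{udom}(g)$, and denote by $Z_a$ (resp. $Z_t$) the set of algebraically (resp. topologically) essential elements with respect to this covering. Assume that [(A5) or (A5$'$)] and [(A6) or (A6$'$)] hold, where (A5): $Y$ is discrete; (A5$'$): $b$ is continuous in the second variable, and $B^\circ g(y)>-\infty$ for all $y\in Y$; (A6): $B^\circ g\in\mathcal{F}_c$; (A6$'$): $b$ is coercive and $X'\subset\mathrm{idom}(g)\cup g^{-1}(-\infty)$. Then Problem $(\mathcal{P}')$ has a solution, and any solution $f$ of $(\mathcal{P}')$ satisfies $$f\geq B^\circ g\quad\text{and}\quad f(y)=B^\circ g(y)\ \text{ for all }y\in Z_a.$$ If, in addition, $B^\circ g$ is quasi-continuous on its domain, and $\mathrm{int}(Z_t)$ denotes the interior of $Z_t$ relatively to $\mathrm{ldom}(B^\circ g)$, then any solution $f$ of $(\mathcal{P}')$ satisfies $$f(y)=B^\circ g(y)\ \text{ for all }y\in\mathrm{int}(Z_t).$$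
   Context: Setting. $\overline{\mathbb{R}}=\mathbb{R}\cup\{\pm\infty\}$ with its usual order and topology. $X,Y$ are nonempty Hausdorff topological spaces, $\mathcal{F}=\mathrm{lsc}(Y,\overline{\mathbb{R}})$ is the set of lower semicontinuous functions $Y\to\overline{\mathbb{R}}$, $\mathcal{G}=\overline{\mathbb{R}}^X$ is the set of all functions $X\to\overline{\mathbb{R}}$, both with the pointwise order. $(B,B^\circ)$, $B:\mathcal{F}\to\mathcal{G}$, $B^\circ:\mathcal{G}\to\mathcal{F}$, is a dual Galois connection: $g\geq Bf\iff f\geq B^\circ g$ for all $f\in\mathcal{F},g\in\mathcal{G}$. Its kernels are the (unique) maps $b:X\times Y\times\overline{\mathbb{R}}\to\overline{\mathbb{R}}$, $b^\circ:Y\times X\times\overline{\mathbb{R}}\to\overline{\mathbb{R}}$ such that for all $(x,y)$, $(b(x,y,\cdot),b^\circ(y,x,\cdot))$ is a dual Galois connection between $\overline{\mathbb{R}}$ and $\overline{\mathbb{R}}$ (i.e. $t\geq b(x,y,s)\iff s\geq b^\circ(y,x,t)$), $b^\circ(\cdot,x,t)\in\mathcal{F}$ for all $x,t$, and $Bf(x)=\sup_{y\in Y}b(x,y,f(y))$, $B^\circ g(y)=\sup_{x\in X}b^\circ(y,x,g(x))$. Standing assumptions. There is a subset $\mathcal{S}\subset X\times Y$ such that: (A1) $\mathcal{S}_x=\{y\in Y\mid(x,y)\in\mathcal{S}\}\neq\emptyset$ for all $x\in X$; (A2) $\mathcal{S}^y=\{x\in X\mid(x,y)\in\mathcal{S}\}\neq\emptyset$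 for all $y\in Y$; (A3) $b(x,y,\cdot)$ is a bijection $\overline{\mathbb{R}}\to\overline{\mathbb{R}}$ for all $(x,y)\in\mathcal{S}$; (A4) $b(x,y,\cdot)\equiv-\infty$ for $(x,y)\in(X\times Y)\setminus\mathcal{S}$. Problem $(\mathcal{P}')$ (for given $g\in\mathcal{G}$, $X'\subset X$): find $f\in\mathcal{F}$ such that $Bf\leq g$ and $Bf(x)=g(x)$ for all $x\in X'$. Domains. For $h:Z\to\overline{\mathbb{R}}$, $Z$ a topological space: $\mathrm{ldom}(h)=\{z\mid h(z)<+\infty\}$, $\mathrm{udom}(h)=\{z\mid h(z)>-\infty\}$, $\mathrm{dom}(h)=\mathrm{ldom}(h)\cap\mathrm{udom}(h)$, $\mathrm{idom}(h)=\{z\in\mathrm{dom}(h)\mid\limsup_{z'\to z}h(z')<+\infty\}$. Subdifferential of $g\in\mathcal{G}$ at $x\in X$: $\partial^\circ g(x)=\{y\in Y\mid(x,y)\in\mathcal{S},\ b^\circ(y,x',g(x'))\leq b^\circ(y,x,g(x))\ \forall x'\in X\}$, and $(\partial^\circ g)^{-1}(y)=\{x\in X\mid y\in\partial^\circ g(x)\}$. Coverings. For a map $F$ from a set $Z$ to the set of subsets of $W$, $Z'\subset Z$, $W'\subset W$: $\{F(z)\}_{z\in Z'}$ is a covering of $W'$ if $\bigcup_{z\in Z'}F(z)\supset W'$. Given such a covering, $y\in Z'$ is algebraically essential if there is $w\in W'$ with $w\notin\bigcup_{z\in Z'\setminus\{y\}}F(z)$; when $Z$ is a topological space, $y\in Z'$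 is topologically essential if for all open neighbourhoods $U$ of $y$ in $Z'$ (induced topology) there is $w\in W'$ with $w\notin\bigcup_{z\in Z'\setminus U}F(z)$. $b$ is continuous in the second variable if $b(x,\cdot,\alpha)$ is continuous for all $x\in X$, $\alpha\in\mathbb{R}$. $b$ is coercive if for all $x\in X$, all neighbourhoods $V$ of $x$ in $X$ and all $\alpha\in\mathbb{R}$, the function $b^\alpha_{x,V}(y)=\sup_{z\in V}b(z,y,b^\circ(y,x,\alpha))$ is such that $\{y\in Y\mid b^\alpha_{x,V}(y)\leq\beta\}$ is relatively compact for all $\beta\in\mathbb{R}$. $\mathcal{F}_c$ is the set of $f\in\mathcal{F}$ such that for all $x\in X$ and $\beta\in\mathbb{R}$, $\{y\in Y\mid b(x,y,f(y))\geq\beta\}$ is relatively compact. A map $h:Z\to W$ between topological spaces is quasi-continuous if for every open $G\subset W$, $h^{-1}(G)$ is included in the closure of its interior. A function $h:Z\to\overline{\mathbb{R}}$ is quasi-continuous on its domain if its restriction to $\mathrm{dom}(h)$, with the induced topology, is quasi-continuous. *)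

(* Defs.v *)
From HB Require Import structures.
From mathcomp Require Import all_boot all_order all_algebra.
From mathcomp Require Import all_classical all_reals all_analysis.

Set Implicit Arguments.
Unset Strict Implicit.
Unset Printing Implicit Defensive.

Import Order.TTheory GRing.Theory Num.Theory.
Import numFieldNormedType.Exports.

Local Open Scope classical_set_scope.
Local Open Scope ereal_scope.

Record lsc (Y : topologicalType) (R : realType) := Lsc {
  lsc_fun :> Y -> \bar R ;
  lsc_funP : `[< lower_semicontinuous lsc_fun >] }.

HB.instance Definition _ (Y : topologicalType) (R : realType) :=
  [isSub for @lsc_fun Y R].
HB.instance Definition _ (Y : topologicalType) (R : realType) :=
  [Choice of lsc Y R by <:].
(* The order inherited from [Y -> \bar R], which is the pointwise one. *)
HB.instance Definition _ (Y : topologicalType) (R : realType) :=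
  [SubChoice_isSubPOrder of lsc Y R by <: with FunOrder.fun_display].

Definition dual_galois {d d'} {S : porderType d} {T : porderType d'}
    (F : S -> T) (Fo : T -> S) : Prop :=
  forall (s : S) (t : T), (F s <= t)%O <-> (Fo t <= s)%O.

Section coverings.
Context {Z W : Type}.

Definition covering (F : Z -> set W) (Z' : set Z) (W' : set W) : Prop :=
  W' `<=` \bigcup_(z in Z') F z.

Definition alg_essential (F : Z -> set W) (Z' : set Z) (W' : set W) : set Z :=
  [set y | Z' y /\
    exists2 w, W' w & ~ (\bigcup_(z in Z' `\ y) F z) w].

End coverings.

(* [subspace Z'] is the type Z with every point outside Z' made isolated, so
   the traces on Z' of its open sets are the relatively open subsets of Z';
   the part of U outside Z' plays no role in [Z' `\` U]. *)
Definition top_essential {Z : topologicalType} {W : Type}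
    (F : Z -> set W) (Z' : set Z) (W' : set W) : set Z := [set y | Z' y /\
  forall U : set (subspace Z'), open_nbhs (y : subspace Z') U ->
    exists2 w, W' w & ~ (\bigcup_(z in Z' `\` U) F z) w].

Definition rel_interior {Z : topologicalType} (D A : set Z) : set Z :=
  D `&` interior (A : set (subspace D)).

Definition quasi_continuous {Z W : topologicalType} (h : Z -> W) : Prop :=
  forall G : set W, open G -> h @^-1` G `<=` closure (interior (h @^-1` G)).

Section domains.
Context {Z : topologicalType} {R : realType}.
Implicit Type h : Z -> \bar R.

Definition ldom h : set Z := [set z | h z < +oo].
Definition udom h : set Z := [set z | -oo < h z].
Definition dom h : set Z := ldom h `&` udom h.

(* The limsup is over full neighbourhoods, z included; as h z < +oo on the
   domain, punctured neighbourhoods would define the same set. *)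
Definition idom h : set Z := [set z | dom h z /\ limf_esup h (nbhs z) < +oo].

(* [sigL A h] is the restriction of h to the subtype of A, which carries the
   induced topology. *)
Definition quasi_continuous_on_dom h : Prop :=
  quasi_continuous (sigL (dom h) h).

End domains.

Section kernels.
Context {X Y : topologicalType} {R : realType}.
Implicit Types (B : lsc Y R -> X -> \bar R) (Bo : (X -> \bar R) -> lsc Y R).
Implicit Types (b : X -> Y -> \bar R -> \bar R) (bo : Y -> X -> \bar R -> \bar R).
Implicit Types (S : set (X * Y)) (g : X -> \bar R).

Definition kernels B Bo b bo : Prop :=
  [/\ forall x y, dual_galois (b x y) (bo y x),
      forall x t, lower_semicontinuous (fun y => bo y x t),
      forall f x, B f x = ereal_sup [set b x y (f y) | y in [set: Y]]
    & forall g y, Bo g y = ereal_sup [set bo y x (g x) | x in [set: X]]].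

Definition subdiff S bo g (x : X) : set Y := [set y | S (x, y) /\
  forall x', bo y x' (g x') <= bo y x (g x)].

Definition subdiff_inv S bo g (y : Y) : set X := [set x | subdiff S bo g x y].

Definition solution B g (X' : set X) (f : lsc Y R) : Prop :=
  (B f <= g)%O /\ forall x, X' x -> B f x = g x.

Definition continuous_snd b : Prop :=
  forall x (a : R), continuous (fun y => b x y a%:E).

Definition coercive b bo : Prop :=
  forall (x : X) (V : set X) (a : R), nbhs x V -> forall c : R,
    precompact [set y | ereal_sup [set b z y (bo y x a%:E) | z in V] <= c%:E].

Definition lsc_c b : set (lsc Y R) := [set f |
  forall x (c : R), precompact [set y | c%:E <= b x y (f y)]].

End kernels.

(* Main.v *)
(** [B] is antitone, so a solution [f] satisfies [Bo g <= f], hence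
    [B f <= B (Bo g) <= g].  The covering hypothesis says that every [w] in [W]
    has a point [y] with [b w y (Bo g y) = g w], so [Bo g] is a solution.
    Conversely, for any solution [f] the supremum defining [B f w = g w] is
    attained, by upper semicontinuity and compactness; at a maximiser [z],
    [f z = bo z w (g w) <= Bo g z <= f z], so [f] and [Bo g] touch at a point of
    the covering set of [w].  An algebraically essential point is the only
    possible touching point for some [w], and touching points accumulate at
    topologically essential points; quasi-continuity of [Bo g] and lower
    semicontinuity of [f] then rule out [Bo g < f] on the interior. *)
Require Import Defs.
From mathcomp Require Import all_boot all_order all_algebra.
From mathcomp Require Import all_classical all_reals all_analysis.
Local Open Scope classical_set_scope.
Local Open Scope ereal_scope.

Import Order.TTheory GRing.Theory Num.Theory.

Lemma ereal_lt_dense (R : realType) (a b : \bar R) :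
  a < b -> exists r : R, a < r%:E /\ r%:E < b.
Proof.
case: a b => [a| |] [b| |] //=; rewrite ?lte_fin => ab.
- by exists ((a + b) / 2)%R; rewrite !lte_fin !midf_lt.
- by exists (a + 1)%R; rewrite lte_fin ltrDl ltr01 ltry.
- by exists (b - 1)%R; rewrite lte_fin ltNyr gtrBl ltr01.
- by exists 0%R; rewrite ltNyr ltry.
Qed.

Section dual_galois_theory.
Context {d d'} {S : porderType d} {T : porderType d'}.
Context {F : S -> T} {Fo : T -> S} (FFo : dual_galois F Fo).

Lemma dual_galois_le s : (Fo (F s) <= s)%O.
Proof. exact/FFo. Qed.

Lemma dual_galois_ge t : (F (Fo t) <= t)%O.
Proof. exact/FFo. Qed.

Lemma dual_galois_anti s s' : (s <= s')%O -> (F s' <= F s)%O.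
Proof. by move=> ss'; apply/FFo/(le_trans (dual_galois_le s)). Qed.

Lemma dual_galois_bijK : bijective F -> cancel F Fo.
Proof.
move=> bijF s; apply: (bij_inj bijF); apply/eqP.
by rewrite eq_le dual_galois_ge dual_galois_anti// dual_galois_le.
Qed.

Lemma dual_galois_bijVK : bijective F -> cancel Fo F.
Proof.
by move=> bijF t; have [G _ GK] := bijF; rewrite -{1}(GK t) dual_galois_bijK.
Qed.

End dual_galois_theory.

(** Superlevel sets at real levels below the supremum generate a proper filter with a precompact
    member, hence with a cluster point; upper semicontinuity keeps [h] from dropping below any such
    level there. *)
Lemma ereal_sup_attained (R : realType) (T : topologicalType) (h : T -> \bar R) :
  (forall y (c : R), h y < c%:E -> \forall z \near y, h z < c%:E) ->
  (forall c : R, precompact [set y | c%:E <= h y]) ->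
  -oo < ereal_sup (range h) -> exists z, h z = ereal_sup (range h).
Proof.
set s := ereal_sup _ => husc hcpt hs.
pose G := [set A : set T | exists2 c : R,
  c%:E < s & [set y | c%:E <= h y] `<=` A].
have GP : ProperFilter G.
  split.
    move=> [c cs]; have [_ [y _ <-] cy] := ereal_sup_gt cs.
    by move/(_ y); apply; exact: ltW.
  split.
  - by have [r [_ rs]] := ereal_lt_dense _ _ _ hs; exists r.
  - move=> A A' [c cs cA] [c' cs' cA'].
    have [cc'|/ltW c'c] := leP c c'; [exists c' => //|exists c => //] => y /= cy.
      by split; [apply: cA; apply: le_trans cy|exact: cA'].
    by split; [exact: cA|apply: cA'; apply: le_trans cy].
  - by move=> A A' AA' [c cs cA]; exists c => //; exact: subset_trans AA'.
have [r [_ rs]] := ereal_lt_dense _ _ _ hs.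
have := hcpt r; rewrite precompactE => /(_ G GP)[|z [_ Gz]].
  by exists r => //; exact: subset_closure.
exists z; apply/eqP; rewrite eq_le ereal_sup_ubound/=; last by exists z.
rewrite leNgt; apply/negP => /ereal_lt_dense[c [hzc cs]].
have [|y [/= cy yc]] := Gz [set y | c%:E <= h y] _ _ (husc _ _ hzc).
  by exists c.
by move: yc; rewrite ltNge cy.
Qed.

(** Moves quasi-continuity from the subtype [dom h] to [Z]: an open set of the subtype is the trace
    of an open [V] of [Z]. *)
Lemma quasi_continuous_on_dom_lt (R : realType) (Z : topologicalType)
    (h : Z -> \bar R) (a : \bar R) (O : set Z) (z : Z) :
  quasi_continuous_on_dom h -> open O -> O z -> dom h z -> h z < a ->
  exists2 V : set Z, open V &
    (exists z', [/\ V z', O z' & dom h z']) /\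
    (forall v, V v -> dom h v -> h v < a).
Proof.
move=> qh oO Oz hz hza; pose zd : dom h := exist _ z (mem_set hz).
have nO : nbhs zd (set_val @^-1` O).
  by apply: (@initial_continuous _ _ (set_val : dom h -> Z) zd O);
    rewrite nbhsE; exists O.
have [u [uint Ou]] := qh _ (open_ereal_lt_ereal (x := a)) zd hza _ nO.
move: uint; rewrite /interior nbhsE => -[_ [[V oV <-] Vu] VG].
exists V => //; split.
  by exists (set_val u); split => //; exact: set_mem (valP u).
by move=> v Vv hv; exact: (VG (exist _ v (mem_set hv))).
Qed.

Section kernel_theory.
Context {R : realType} {X Y : topologicalType}.
Context {B : lsc Y R -> X -> \bar R} {Bo : (X -> \bar R) -> lsc Y R}.
Context {b : X -> Y -> \bar R -> \bar R} {bo : Y -> X -> \bar R -> \bar R}.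
Context (hB : dual_galois B Bo) (hb : kernels B Bo b bo).
Context {S : set (X * Y)}.
Context (A3 : forall x y, S (x, y) -> bijective (b x y)).
Context (A4 : forall x y, ~ S (x, y) -> forall s, b x y s = -oo).
Context (g : X -> \bar R).
Implicit Types (f : lsc Y R) (w x : X) (y z : Y).

(** On [S], [bo y x t = s] would force [b x y s = t] by bijectivity; off [S], [b x y] is constantly
    [-oo], hence so is [bo y x]. *)
Lemma kernel_lt_dual x y s t : b x y s < t -> bo y x t < s \/ bo y x t = -oo.
Proof.
have [/(_ x y) bbo _ _ _] := hb => bst.
have [Sxy|nS] := pselect (S (x, y)); last first.
  right; apply/eqP; rewrite -leeNy_eq.
  by apply/bbo; rewrite A4// leNye.
left; rewrite lt_neqAle; apply/andP; split; last exact/bbo/ltW.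
apply/eqP => bots; move: bst.
by rewrite -bots (dual_galois_bijVK bbo (A3 _ _ Sxy)) ltxx.
Qed.

Lemma kernel_usc f x : continuous_snd b -> (forall y, -oo < f y) ->
  forall y (c : R), b x y (f y) < c%:E -> \forall z \near y, b x z (f z) < c%:E.
Proof.
have [bbo _ _ _] := hb.
(* The Galois connection only returns [b x y r <= c']; the intermediate [c'] makes the bound by [c]
   strict. The real [r] below [f y] replaces the varying argument [f z] by a constant, where
   continuity in the second variable applies. *)
move=> bcont finf y c /ereal_lt_dense[c' [bc' c'c]].
have {bc'} bof : bo y x c'%:E < f y.
  by have [//|->] := kernel_lt_dual _ _ _ _ bc'.
have [r [bor rf]] := ereal_lt_dense _ _ _ bof.
have brc : b x y r%:E < c%:E.
  by apply: le_lt_trans c'c; apply/bbo/ltW.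
have /asboolW/(_ _ _ rf)[V nV rV] := lsc_funP f.
near=> z; apply: (@le_lt_trans _ _ (b x z r%:E)).
  by apply: (dual_galois_anti (bbo x z)); apply/ltW/rV; near: z.
near: z; apply: (bcont x r y [set t | t < c%:E]).
exact: (open_nbhs_nbhs (conj (open_ereal_lt_ereal (x := c%:E)) brc)).
Unshelve. all: by end_near. Qed.

Lemma kernel_le_solution f x y X' : solution B g X' f -> b x y (f y) <= g x.
Proof.
move=> [/asboolP Bfg _]; have [_ _ Bf _] := hb.
by apply: le_trans (Bfg x); rewrite Bf; apply: ereal_sup_ubound; exists y.
Qed.

Lemma lsc_c_superlevel f x (c : R) : lsc_c b (Bo g) -> (forall y, Bo g y <= f y) ->
  precompact [set y | c%:E <= b x y (f y)].
Proof.
have [bbo _ _ _] := hb.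
move=> + gf => /(_ x c); apply: precompact_subset => y /= /le_trans; apply.
exact: dual_galois_anti (bbo x y) _ _ (gf y).
Qed.

(* Near a point of [idom g], [g] is bounded by some [M], and [c <= b x y (f y)]
   gives [f y <= bo y x c], so [y] lies in a sublevel set of the coercivity
   functional. *)
Lemma coercive_superlevel f x (c : R) X' : coercive b bo -> idom g x ->
  solution B g X' f -> precompact [set y | c%:E <= b x y (f y)].
Proof.
have [bbo _ _ _] := hb.
move=> bcoer [_ /ereal_inf_lt[_ [V nV <-] /ereal_lt_dense[M [gM _]]]] fsol.
apply: precompact_subset (bcoer x V c nV M) => y /= cb.
apply: ge_ereal_sup => _ [z Vz <-].
have Sxy : S (x, y).
  by apply: contrapT => /A4/(_ (f y)) bE; move: cb; rewrite bE.
have fbo : f y <= bo y x c%:E.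
  rewrite -(dual_galois_bijK (bbo x y) (A3 _ _ Sxy) (f y)).
  apply/bbo; rewrite (dual_galois_bijVK (bbo x y) (A3 _ _ Sxy)) //.
apply: le_trans (dual_galois_anti (bbo z y) _ _ fbo) _.
apply: le_trans (kernel_le_solution f z y X' fsol) _.
by apply: le_trans (ltW gM); apply: ereal_sup_ubound; exists z.
Qed.

Lemma solution_ge f X' : solution B g X' f -> forall y, Bo g y <= f y.
Proof. by case=> /hB /asboolP. Qed.

Lemma covering_solution X' :
  covering (subdiff_inv S bo g) (ldom (Bo g)) (X' `&` udom g) ->
  solution B g X' (Bo g).
Proof.
have [bbo _ BE BoE] := hb => cov.
have Bg : (B (Bo g) <= g)%O := dual_galois_ge hB g.
split=> // x X'x; apply/eqP; rewrite eq_le; move/asboolP : (Bg) => -> /=.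
have [gx|gx] := ltP -oo (g x); last by rewrite (le_trans gx)// leNye.
have [y _ [Sxy xmax]] := cov x (conj X'x gx).
(* A subgradient [y] at [x] makes [x] a maximiser in the supremum defining [Bo g y]; then [b x y] is
   inverted on [S]. *)
have -> : g x = b x y (Bo g y).
  rewrite -{1}(dual_galois_bijVK (bbo x y) (A3 _ _ Sxy) (g x)).
  congr (b x y _); apply/eqP; rewrite BoE eq_le ereal_sup_ubound/=; last by exists x.
  by apply: ge_ereal_sup => _ [x' _ <-].
by rewrite BE; apply: ereal_sup_ubound; exists y.
Qed.

Lemma solution_contact X' f w :
  (forall y (c : R), b w y (f y) < c%:E ->
    \forall z \near y, b w z (f z) < c%:E) ->
  (forall c : R, precompact [set y | c%:E <= b w y (f y)]) ->
  solution B g X' f -> (X' `&` udom g) w ->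
  exists z, [/\ ldom (Bo g) z, subdiff_inv S bo g z w & f z = Bo g z].
Proof.
have [bbo _ BE BoE] := hb => usc cpt fsol [X'w gw].
have Bfw : ereal_sup (range (fun y => b w y (f y))) = g w.
  by rewrite -(fsol.2 w X'w) BE.
have [|z] := ereal_sup_attained _ _ _ usc cpt; rewrite Bfw// => bz.
have Swz : S (w, z).
  by apply: contrapT => /A4/(_ (f z)) bE; move: gw; rewrite /udom/= -bz bE.
have fz : f z = bo z w (g w).
  by rewrite -bz (dual_galois_bijK (bbo w z) (A3 _ _ Swz)).
have bog x : bo z x (g x) <= Bo g z by rewrite BoE; apply: ereal_sup_ubound; exists x.
have fBo : f z = Bo g z.
  by apply/eqP; rewrite eq_le (solution_ge _ _ fsol) andbT fz bog.
exists z; split=> //; last by split=> // x; rewrite -fz fBo.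
(* If [f z] were [+oo], then [b w z (f z)] would be [-oo], whereas it equals [g w > -oo]. *)
rewrite /ldom/= -fBo ltNge; apply/negP; rewrite leye_eq => /eqP fy.
have : b w z +oo <= -oo by apply/bbo; rewrite leey.
by rewrite -fy bz leNgt gw.
Qed.

End kernel_theory.

Theorem theorem4p6 (R : realType) (X Y : topologicalType)
    (hX : hausdorff_space X) (hY : hausdorff_space Y)
    (X0 : [set: X] !=set0) (Y0 : [set: Y] !=set0)
    (B : lsc Y R -> (X -> \bar R)) (Bo : (X -> \bar R) -> lsc Y R)
    (hB : dual_galois B Bo)
    (b : X -> Y -> \bar R -> \bar R) (bo : Y -> X -> \bar R -> \bar R)
    (hb : kernels B Bo b bo)
    (S : set (X * Y))
    (A1 : forall x : X, exists y : Y, S (x, y))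
    (A2 : forall y : Y, exists x : X, S (x, y))
    (A3 : forall x y, S (x, y) -> bijective (b x y))
    (A4 : forall x y, ~ S (x, y) -> forall s, b x y s = -oo)
    (X' : set X) (g : X -> \bar R)
    (F := subdiff_inv S bo g)
    (D := ldom (Bo g))
    (W := X' `&` udom g)
    (hcov : covering F D W)
    (Za := alg_essential F D W)
    (Zt := top_essential F D W)
    (hA5 : (forall A : set Y, open A) \/
           (continuous_snd b /\ forall y, -oo < Bo g y))
    (hA6 : lsc_c b (Bo g) \/
           (coercive b bo /\ X' `<=` idom g `|` g @^-1` [set -oo])) :
  [/\ exists f : lsc Y R, solution B g X' f,
      forall f : lsc Y R, solution B g X' f ->
        (Bo g <= f)%O /\ (forall y, Za y -> f y = Bo g y)
    & quasi_continuous_on_dom (Bo g) ->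
        forall f : lsc Y R, solution B g X' f ->
          forall y, rel_interior D Zt y -> f y = Bo g y].
Proof.
have contact f w : solution B g X' f -> W w ->
    exists z, [/\ D z, F z w & f z = Bo g z].
  move=> fsol Ww; have gf := solution_ge hB g f X' fsol.
  apply: (solution_contact hB hb A3 A4 g X') => //.
  - case: hA5 => [disc y c fc|[bcont Bog] y c].
      by apply: filterS (open_nbhs_nbhs (conj (disc [set y]) erefl)) => _ ->.
    by apply: (kernel_usc hb A3 A4) => // z; exact: lt_le_trans (gf z).
  - move=> c; case: hA6 => [Boc|[bcoer X'dom]].
      exact: (lsc_c_superlevel hb g).
    apply: (coercive_superlevel hb A3 A4 g f w c X') => //.
    by case: Ww => /X'dom[//|/= gw]; rewrite /udom/= gw.
split; first by exists (Bo g); exact: (covering_solution hB hb A3).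
  move=> f fsol; split; first by apply/hB; case: fsol.
  move=> y [_ [w Ww nw]]; have [z [Dz Fzw fz]] := contact f w fsol Ww.
  suff <- : z = y by [].
  by apply: contrapT => zy; apply: nw; exists z.
move=> qBo f fsol y [Dy yint].
(* Essentiality of [y'] gives a [w] not covered from outside [O], so the contact point attached to
   [w] must lie in [O]. *)
have close (O : set Y) : open O -> (exists2 y', O y' & Zt y') ->
    exists z, [/\ O z, D z & f z = Bo g z].
  move=> oO [y' Oy' [_ /(_ O)]] [|w Ww nw].
    by split=> //; exact: open_subspaceW.
  have [z [Dz Fzw fz]] := contact f w fsol Ww.
  exists z; split => //; apply: contrapT => nOz; apply: nw.
  by exists z.
case: hA5 => [disc|[bcont Bog]].
  have [|z [-> //]] := close [set y] (disc _).
  by exists y => //; exact: interior_subset yint.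
apply/eqP; rewrite eq_le (solution_ge hB g f X' fsol) andbT leNgt.
apply/negP => /ereal_lt_dense[c [Boc cf]].
have domE z : D z -> dom (Bo g) z by move=> Dz; split => //; exact: Bog.
(* The relative interior becomes an open [U] of [Y] with [U] and [D] meeting inside [Zt]. *)
have : nbhs y [set z | D z -> Zt z].
  by have : nbhs_subspace (y : subspace D) Zt by [];
    rewrite -(nbhs_subspace_in Dy).
rewrite nbhsE => -[U [oU Uy] UZt].
have oc : open [set z | c%:E < f z].
  exact: (iffLR (lower_semicontinuousP f) (asboolW (lsc_funP f))) c.
(* Quasi-continuity gives [Bo g < c] on the part of [V] in the domain, and [V] meets [U] and [c < f]
   at an essential point [y']. A contact point in that intersection would have
   [c < f z = Bo g z < c]. *)
have [V oV [[y' [Vy' [Oy' cy'] [Dy' _]]] Vc]] :=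
  quasi_continuous_on_dom_lt _ _ _ _ _ _ qBo (openI oU oc) (conj Uy cf)
    (domE y Dy) Boc.
have [|z [[Vz [_ cz]] Dz fz]] := close _ (openI oV (openI oU oc)).
  by exists y' => //; exact: UZt.
by have := Vc z Vz (domE z Dz); rewrite -fz ltNge (ltW cz).
Qed.
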